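(* Let $G$ be a connected Lie group and $H\subset G$ a closed, compact, connected subgroup, with $p_0=H\in G/H$. Let $f$ be a compactly supported continuous real-valued function on $G/H$, and define $k_{\mathrm{ReLU},f}:G/H\to\mathbb{R}$ by $k_{\mathrm{ReLU},f}(p)=0$ if $p=p_0$ and $k_{\mathrm{ReLU},f}(p)=\sup_{q\in G/H}f(q)$ otherwise. Then for all $p\in G/H$: $$-\left(k_{\mathrm{ReLU},f}\,\square_G\,(-f)\right)(p)=\max\{0,f(p)\}.$$
   Context: $G/H$ is the manifold of left cosets with the action $g(g'H)=(gg')H$. Morphological group convolution: $(k\,\square_G\,f)(p)=\inf_{g\in G}\{k(g^{-1}p)+f(gp_0)\}$.
   Formalization: The subgroup H is assumed to be a proper subgroup of G; for H = G compact, G/H is a single point and f = −1 gives left-hand side −1 but right-hand side 0. *)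

(* Defs.v *)
From HB Require Import structures.
From mathcomp Require Import all_boot all_order all_algebra.
From mathcomp Require Import all_classical all_reals all_analysis.

Set Implicit Arguments.
Unset Strict Implicit.
Unset Printing Implicit Defensive.

Import Order.TTheory GRing.Theory Num.Theory.
Import numFieldNormedType.Exports.

Local Open Scope classical_set_scope.
Local Open Scope ring_scope.

(* [A] is meant to be open and [V] finite-dimensional, so that continuity at
   every point of [A] is continuity of the restriction, and "differentiable with
   all directional derivatives of class C^k" is "of class C^(k+1)". *)
Fixpoint Ck_on (R : realType) (V W : normedModType R) (k : nat) (A : set V)
    (f : V -> W) : Prop :=
  if k is k'.+1 then
    (forall x, A x -> differentiable f x) /\
    (forall v : V, Ck_on k' A (fun x => 'D_v f x))
  else forall x, A x -> {for x, continuous f}.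

Definition smooth_on (R : realType) (V W : normedModType R) (A : set V)
    (f : V -> W) : Prop :=
  forall k, Ck_on k A f.

(* A homeomorphism from an open set of [M] onto an open set of R^n, represented
   by total functions that are only relevant on these two sets. *)
Record chart (R : realType) (n : nat) (M : topologicalType) := Chart {
  chart_dom : set M;
  chart_fun :> M -> 'rV[R]_n;
  chart_inv : 'rV[R]_n -> M;
  chart_dom_open : open chart_dom;
  chart_img_open : open (chart_fun @` chart_dom);
  chart_funK : forall x, chart_dom x -> chart_inv (chart_fun x) = x;
  chart_fun_continuous : forall x, chart_dom x -> {for x, continuous chart_fun};
  chart_inv_continuous : forall y, (chart_fun @` chart_dom) y ->
    {for y, continuous chart_inv}
}.

Definition chart_img (R : realType) (n : nat) (M : topologicalType)
    (c : chart R n M) : set 'rV[R]_n :=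
  c @` chart_dom c.

HB.mixin Record isSmoothManifold (R : realType) M of Topological M := {
  manifold_dim : nat;
  atlas : set (chart R manifold_dim M);
  manifold_hausdorff : hausdorff_space M;
  manifold_second_countable : @second_countable M;
  atlas_cover : forall x : M, exists2 c, atlas c & chart_dom c x;
  atlas_compatible : forall c1 c2, atlas c1 -> atlas c2 ->
    smooth_on (c1 @` (chart_dom c1 `&` chart_dom c2))
              (fun x => c2 (chart_inv c1 x))
}.

#[short(type="smoothManifoldType")]
HB.structure Definition SmoothManifold (R : realType) :=
  {M of isSmoothManifold R M & Topological M}.

HB.mixin Record isTopologicalGroup G of Group G & Topological G := {
  mulg_continuous : continuous (fun xy : G * G => (xy.1 * xy.2)%g);
  invg_continuous : continuous (fun x : G => x^-1%g)
}.

#[short(type="topologicalGroupType")]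
HB.structure Definition TopologicalGroup :=
  {G of isTopologicalGroup G & Group G & Topological G}.

(* Smoothness of multiplication and inversion, read in charts; the domains are
   the open sets on which the expressions in coordinates make sense. *)
HB.mixin Record isLieGroup (R : realType) G
    of SmoothManifold R G & TopologicalGroup G := {
  mulg_smooth : forall c1 c2 c3 : chart R (@manifold_dim R G) G,
    atlas c1 -> atlas c2 -> atlas c3 ->
    smooth_on
      [set xy : 'rV[R]_(@manifold_dim R G) * 'rV[R]_(@manifold_dim R G) |
        [/\ chart_img c1 xy.1, chart_img c2 xy.2 &
            chart_dom c3 (chart_inv c1 xy.1 * chart_inv c2 xy.2)%g]]
      (fun xy => c3 (chart_inv c1 xy.1 * chart_inv c2 xy.2)%g);
  invg_smooth : forall c1 c2 : chart R (@manifold_dim R G) G,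
    atlas c1 -> atlas c2 ->
    smooth_on
      [set x | chart_img c1 x /\ chart_dom c2 ((chart_inv c1 x)^-1)%g]
      (fun x => c2 ((chart_inv c1 x)^-1)%g)
}.

#[short(type="lieGroupType")]
HB.structure Definition LieGroup (R : realType) :=
  {G of isLieGroup R G & SmoothManifold R G & TopologicalGroup G}.

Section CosetSpace.
Context {G : topologicalGroupType} (H : groupClosed G).
Local Open Scope group_scope.
Local Open Scope quotient_scope.

(* xH = yH, as left cosets *)
Definition lcoset_rel : rel G := fun x y => x^-1 * y \in H.

Lemma lcoset_rel_refl : reflexive lcoset_rel.
Proof. by move=> x; rewrite /lcoset_rel mulVg gpred1. Qed.

Lemma lcoset_rel_sym : symmetric lcoset_rel.
Proof. by move=> x y; rewrite /lcoset_rel -gpredV invgM invgK. Qed.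

Lemma lcoset_rel_trans : transitive lcoset_rel.
Proof.
move=> y x z xy yz; rewrite /lcoset_rel.
by rewrite -(mulgK y x^-1) -mulgA gpredM// -?mulgA.
Qed.

Definition lcoset_equiv : equiv_rel G :=
  EquivRel lcoset_rel lcoset_rel_refl lcoset_rel_sym lcoset_rel_trans.

Definition coset_space := quotient_topology {eq_quot lcoset_equiv}.

Definition coset (g : G) : coset_space := \pi_coset_space g.

Definition base_coset : coset_space := coset 1.

Definition coset_act (g : G) (p : coset_space) : coset_space :=
  coset (g * repr p).

Lemma coset_eqP (x y : G) : coset x = coset y <-> x^-1 * y \in H.
Proof. by split=> [/(@eqmodP _ lcoset_equiv)|/(@eqmodP _ lcoset_equiv)]. Qed.

Lemma coset_actE (g g' : G) : coset_act g (coset g') = coset (g * g').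
Proof.
apply/coset_eqP; rewrite invgM -mulgA mulKg.
by apply/coset_eqP; exact: reprK.
Qed.

End CosetSpace.

Section Morphological.
Context {R : realType} {G : topologicalGroupType} {H : groupClosed G}.
Local Open Scope ring_scope.

Definition morph_conv (k f : coset_space H -> R) (p : coset_space H) : \bar R :=
  ereal_inf
    [set (k (coset_act g^-1%g p) + f (coset_act g (base_coset H)))%:E
      | g in [set: G]].

Definition k_relu (f : coset_space H -> R) (p : coset_space H) : R :=
  if p == base_coset H then 0 else sup (range f).

Definition compactly_supported (f : coset_space H -> R) : Prop :=
  compact (closure [set q | f q != 0]).

End Morphological.

(* Main.v *)
(** Taking [g] with [g p_0 = p] in the infimum contributes [- f p], while the
    other [g] contribute [sup f - f q], with [q = g p_0] running over the cosets
    different from [p].  So everything reduces to [sup_(q != p) f q = sup f].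
    Were it to fail, [{p}] would be a superlevel set of [f], hence open; being
    also closed, it would be all of the connected space [G / H]. *)
Require Import Defs.
From mathcomp Require Import all_boot all_order all_algebra.
From mathcomp Require Import all_classical all_reals all_analysis.
Import Order.TTheory GRing.Theory Num.Theory.
Import numFieldNormedType.Exports.
Local Open Scope classical_set_scope.
Local Open Scope ring_scope.

Section CosetSpaceTopology.
Context {G : topologicalGroupType} {H : groupClosed G}.

Lemma continuous_coset : continuous (coset H).
Proof. exact: pi_continuous. Qed.

Lemma coset_repr (p : coset_space H) : coset H (repr p) = p.
Proof. exact: reprK. Qed.

Lemma coset_act_base (g : G) : coset_act g (base_coset H) = coset H g.
Proof. by rewrite coset_actE mulg1. Qed.

(** Turns the case split of [k_relu] at [g^-1 p] into a condition on [g p_0], the point where [f] is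
    evaluated. *)
Lemma coset_actV_eq_base (g : G) (p : coset_space H) :
  (coset_act g^-1%g p == base_coset H) = (coset H g == p).
Proof.
rewrite -(coset_repr p) coset_actE.
apply/eqP/eqP => [/esym/coset_eqP h|/coset_eqP h].
  by apply/coset_eqP; move: h; rewrite invg1 mul1g.
by apply/esym/coset_eqP; rewrite invg1 mul1g.
Qed.

Lemma continuous_mulgl (a : G) : continuous (fun x : G => (a * x)%g).
Proof.
move=> x.
apply: (@continuous_comp _ _ _ (fun x => (a, x)) (fun xy => (xy.1 * xy.2)%g)).
  by apply: cvg_pair => //=; exact: cvg_cst.
exact: mulg_continuous.
Qed.

(** The fiber is the translate of [H] by [repr p], hence the preimage of [H] under a continuous left
    translation. *)
Lemma closed_coset_fiber (p : coset_space H) :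
  closed [set` H] -> closed [set g | coset H g = p].
Proof.
move=> H_closed.
have -> : [set g | coset H g = p] =
    (fun x => ((repr p)^-1 * x)%g) @^-1` [set` H].
  apply/seteqP; split=> g /=.
    by move=> /esym; rewrite -{1}(coset_repr p) => /coset_eqP.
  by move=> h; rewrite -[RHS]coset_repr; apply/esym/coset_eqP.
by apply: preimage_closed => // x _; exact: continuous_mulgl.
Qed.

(** An open fiber would be clopen and nonempty, hence all of [G]; then [coset H] would be constant
    and [H] would be [G]. Arguing in [G] uses its connectedness directly. *)
Lemma coset_fiber_not_open (p : coset_space H) :
  connected [set: G] -> closed [set` H] -> [set` H] `<` [set: G] ->
  ~ open [set g | coset H g = p].
Proof.
move=> G_connected H_closed [_ H_proper] A_open; apply: H_proper => g _ /=.
have A_setT : [set g | coset H g = p] = [set: G].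
  apply: G_connected.
  - by exists (repr p); exact: coset_repr.
  - by exists [set g | coset H g = p]; rewrite ?setTI.
  - by exists [set g | coset H g = p]; rewrite ?setTI//; exact: closed_coset_fiber.
have cosetE (x : G) : coset H x = p.
  by have : [set: G] x by []; rewrite -A_setT.
have /coset_eqP : coset H 1%g = coset H g by rewrite !cosetE.
by rewrite invg1 mul1g.
Qed.

End CosetSpaceTopology.

Lemma compactly_supported_has_sup (R : realType) (G : topologicalGroupType)
    (H : groupClosed G) (f : coset_space H -> R) :
  continuous f -> compactly_supported f -> has_sup (range f).
Proof.
move=> f_continuous f_supp.
split; first by exists (f (base_coset H)), (base_coset H).
have : compact (f @` closure [set q | f q != 0]).
  by apply: continuous_compact => //; exact: continuous_subspaceT.
move=> /compact_bounded[M [_ Mf]].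
(* The 0 covers points where [f] vanishes; [M + 1] is used because [Mf] only bounds by reals
   strictly above [M]. *)
exists (Num.max 0 (M + 1)) => _ [q _ <-].
have [->|fq0] := eqVneq (f q) 0; first by rewrite le_max lexx.
rewrite le_max; apply/orP; right.
apply: (le_trans (ler_norm _)); apply: (Mf (M + 1)); first by rewrite ltrDl.
by exists q => //; exact: subset_closure.
Qed.

Lemma sup_range_adherent_neq (R : realType) (G : topologicalGroupType)
    (H : groupClosed G) (f : coset_space H -> R) (p : coset_space H) (e : R) :
  connected [set: G] -> closed [set` H] -> [set` H] `<` [set: G] ->
  continuous f -> has_sup (range f) -> 0 < e ->
  exists2 q, q != p & sup (range f) - e < f q.
Proof.
move=> G_connected H_closed H_proper f_continuous f_sup e_gt0.
apply: contrapT => no_q.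
have le_f q : q != p -> f q <= sup (range f) - e.
  by move=> qp; rewrite leNgt; apply/negP => fq; apply: no_q; exists q.
apply: (@coset_fiber_not_open G H p) => //.
have -> : [set g | coset H g = p] =
    (f \o coset H) @^-1` [set x | sup (range f) - e < x].
  (* Some value of [f] exceeds [sup (range f) - e], and only [p] can take it, so the superlevel set
     is exactly [p]. *)
  have [_ [q _ <-] fq] := sup_adherent e_gt0 f_sup.
  have qp : q = p by apply: contra_ltP fq => /eqP; exact: le_f.
  apply/seteqP; split=> g /=; first by move=> ->; rewrite -qp.
  by apply: contraPP => /eqP/le_f; rewrite leNgt => /negP.
apply: open_comp; last exact: open_gt.
by move=> g _; apply: continuous_comp; [exact: continuous_coset|exact: f_continuous].
Qed.

Theorem proposition6p3 (R : realType) (G : lieGroupType R) (H : groupClosed G)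
  (G_connected : connected [set: G])
  (H_closed : closed [set` H])
  (H_compact : compact [set` H])
  (H_connected : connected [set` H])
  (H_proper : [set` H] `<` [set: G])
  (f : coset_space H -> R)
  (f_continuous : continuous f)
  (f_supp : compactly_supported f)
  (p : coset_space H) :
  (- morph_conv (k_relu f) (fun q => - f q)%R p)%E = (Num.max 0 (f p))%:E.
Proof.
have f_sup := compactly_supported_has_sup _ _ _ _ f_continuous f_supp.
have le_sup q : f q <= sup (range f).
  by apply: ub_le_sup; [exact: f_sup.2|exists q].
have termE g : k_relu f (coset_act g^-1%g p) - f (coset_act g (base_coset H)) =
    (if coset H g == p then 0 else sup (range f)) - f (coset H g).
  by rewrite /k_relu coset_actV_eq_base coset_act_base.
rewrite -[RHS]oppeK; congr (- _)%E; apply/eqP; rewrite eq_le; apply/andP; split.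
- have inf_le g : (morph_conv (k_relu f) (fun q => - f q)%R p <=
      ((if coset H g == p then 0 else sup (range f)) - f (coset H g))%:E)%E.
    by rewrite -termE; apply: ereal_inf_lbound; exists g.
  (* If [f p] is nonnegative, [g = repr p] gives the term [- f p]. *)
  have [fp_ge0|fp_lt0] := leP 0 (f p).
    by have := inf_le (repr p); rewrite coset_repr eqxx sub0r.
  (* Here the target is 0, which may only be approached: [sup (range f)] need not be attained away
     from [p]. *)
  rewrite oppe0; apply/lee_addgt0Pr => e e_gt0; rewrite add0e.
  have [q qp fq] := sup_range_adherent_neq _ _ _ _ p _
    G_connected H_closed H_proper f_continuous f_sup e_gt0.
  apply: (le_trans (inf_le (repr q))).
  by rewrite coset_repr (negbTE qp) lee_fin lerBlDr -lerBlDl ltW.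
(* Conversely, each term is either [- f p] or a nonnegative gap below the supremum. *)
- apply: le_ereal_inf_tmp => _ [g _ <-]; rewrite termE -EFinN lee_fin lerNl opprB.
  have [->|_] := eqVneq (coset H g) p; first by rewrite subr0 le_max lexx orbT.
  by rewrite le_max subr_le0 le_sup.
Qed.
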